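(* Let $b\ge 1$ be an integer and let $\mathcal{B}_b$ be the set of real-valued functions $g:\mathbb{R}\to\mathbb{R}$ of the form $g(t)=\sum_{k=-b}^{b}a_k\exp(j2\pi kt)$ with $a_k\in\mathbb{C}$ and $|g(t)|\le 1$ for all $t$. Let $U,U_1,U_2,\ldots$ be i.i.d. random variables uniformly distributed on $[0,1]$, and for $g\in\mathcal{B}_b$, $n\geq 1$, $x\in[-1,1]$ put $$F_{g,n}(x)=\frac1n\sum_{i=1}^{n}\mathbf{1}\bigl(g(U_i)\le x\bigr).$$ Then a field $g\in\mathcal{B}_b$ cannot be inferred uniquely from the sample values $g(U_1),\ldots,g(U_n)$ (equivalently from $F_{g,n}$) without knowledge of $U_1,\ldots,U_n$, even as $n\to\infty$, in the following sense. For every $g\in\mathcal{B}_b$, almost surely $F_{g,n}(x)\to\mathbb{P}(g(U)\le x)$ for all $x\in[-1,1]$ as $n\to\infty$. For every $g\in\mathcal{B}_b$ and every $0<\theta<1$, the shifted field $g_\theta(t):=g(t-\theta)$ satisfies $$\mathbb{P}(g_\theta(U)\le x)=\mathbb{P}(g(U)\le x)\quad\text{for all }x\in[-1,1].$$ Consequently the limit of $F_{g,n}$ does not determine $g$: there exist distinct $g,h\in\mathcal{B}_b$ with $\mathbb{P}(g(U)\le x)=\mathbb{P}(h(U)\le x)$ for all $x\in[-1,1]$.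
   Context: Here $j=\sqrt{-1}$ and $\mathbf{1}(\cdot)$ denotes the indicator of an event. Functions in $\mathcal{B}_b$ are periodic with period $1$; they are the real-valued bandlimited fields with bound $1$ considered. *)

(* Defs.v *)
From HB Require Import structures.
From mathcomp Require Export all_boot all_order all_algebra.
From mathcomp Require Export complex finmap.
From mathcomp Require Export all_classical all_reals all_analysis.

Set Implicit Arguments.
Unset Strict Implicit.
Unset Printing Implicit Defensive.

Import Order.TTheory GRing.Theory Num.Theory.
Import numFieldNormedType.Exports.

Local Open Scope classical_set_scope.
Local Open Scope ring_scope.

(* exp (x + j y) = exp x (cos y + j sin y); the libraries only have the real
   exponential. *)
Definition cexp (R : realType) (z : R[i]) : R[i] :=
  ((expR (complex.Re z) * cos (complex.Im z)) +i*
   (expR (complex.Re z) * sin (complex.Im z)))%C.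

(* The class B_b. The summation index m in {0, ..., 2b} encodes the frequency
   k = m - b in {-b, ..., b}; only the values a k with |k| <= b are used. *)
Definition bandlimited (R : realType) (b : nat) : set (R -> R) :=
  [set g | (exists a : int -> R[i], forall t : R,
              (g t)%:C%C =
              \sum_(m < (2 * b).+1)
                 let k : int := m%:Z - b%:Z in
                 a k * cexp ('i%C * (2 * pi * k%:~R * t)%:C%C))
           /\ (forall t : R, `|g t| <= 1)].

(* Product rule over every finite subfamily. *)
Definition mutually_independent d (T : measurableType d) (R : realType)
    (P : probability T R) (I : choiceType) (X : I -> {RV P >-> R}) : Prop :=
  forall (J : {fset I}) (B : I -> set R),
    (forall i, i \in J -> measurable (B i)) ->
    P (\bigcap_(i in [set` J]) (X i @^-1` B i)) =
    (\prod_(i <- J) P (X i @^-1` B i))%E.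

Definition uniform01 d (T : measurableType d) (R : realType)
    (P : probability T R) (X : {RV P >-> R}) : Prop :=
  forall A : set R, measurable A ->
    distribution P X A = uniform_prob (@ltr01 R) A.

(* F_{g,n}(x) for the sample points u 1, ..., u n. *)
Definition empirical_cdf (R : realType) (g : R -> R) (u : nat -> R)
    (n : nat) (x : R) : R :=
  n%:R^-1 * \sum_(1 <= i < n.+1) \1_[set y | g y <= x] (u i).

Definition shift_field (R : realType) (theta : R) (g : R -> R) : R -> R :=
  fun t => g (t - theta).

(* Main.v *)
From HB Require Import structures.
From mathcomp Require Import measurable_realfun ring lra zify.
Require Import Defs.

Set Implicit Arguments.
Unset Strict Implicit.
Unset Printing Implicit Defensive.

Import Order.TTheory GRing.Theory Num.Theory.
Import numFieldNormedType.Exports.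

Local Open Scope classical_set_scope.
Local Open Scope ring_scope.

(* A field in [bandlimited b] is continuous and 1-periodic, so translation
   invariance of Lebesgue measure makes the law of [g (U - theta)] independent
   of [theta]; [cos (2 pi t)] and its half-period shift are then distinct fields
   with the same law.

   The convergence is the Glivenko-Cantelli theorem. Pairwise independence
   bounds the second moment of a centred count of n events by n, so that the
   means over the first k^2 samples are square-summable almost surely; since the
   summands are bounded, the means over n samples follow. Finally, convergence
   at the rationals and at the quantiles of rational level, a countable set,
   forces convergence everywhere by monotonicity, including at atoms. *)

(** * Bandlimited fields as real trigonometric sums *)

Section trig.
Context {R : realType}.
Implicit Types (b : nat) (g : R -> R) (t x y : R).

(** Since [g] is real, taking real parts of its complex expansion loses nothing; periodicity and
    continuity then reduce to those of [cos] and [sin]. *)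
Lemma bandlimited_cos_sin b g : bandlimited b g ->
  exists c s : nat -> R, forall t, g t = \sum_(m < (2 * b).+1)
    (c m * cos (2 * pi * (m%:Z - b%:Z)%:~R * t) -
     s m * sin (2 * pi * (m%:Z - b%:Z)%:~R * t)).
Proof.
move=> [[a ga] _].
exists (fun m => complex.Re (a (m%:Z - b%:Z))).
exists (fun m => complex.Im (a (m%:Z - b%:Z))) => t.
have ReD : {morph @complex.Re R : x y / x + y} by case=> ? ? [].
have /(congr1 (@complex.Re R)) := ga t.
rewrite (big_morph _ ReD (erefl _)) /= => ->.
apply: eq_bigr => m _.
set z := _ * t.
have -> : 'i%C * z%:C%C = (0 +i* z)%C by simpc.
by rewrite /cexp /= expR0 !mul1r; case: (a _).
Qed.

Lemma periodic_mulint (f : R -> R) T (k : int) t :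
  periodic f T -> f (t + T * k%:~R) = f t.
Proof.
move=> fT; case: k => n; first by rewrite mulr_natr periodicn.
rewrite NegzE mulrNz mulrN -(periodicn fT n.+1) -mulr_natr.
by rewrite subrK.
Qed.

Lemma bandlimited_periodic b g t : bandlimited b g -> g (t + 1) = g t.
Proof.
move=> /bandlimited_cos_sin[c [s gE]]; rewrite !gE; apply: eq_bigr => m _.
rewrite mulrDr mulr1 mulr_natl.
by rewrite !periodic_mulint//; [exact: sinD2pi|exact: cosD2pi].
Qed.

Lemma bandlimited_continuous b g : bandlimited b g -> continuous g.
Proof.
move=> /bandlimited_cos_sin[c [s gE]]; have -> := funext gE.
apply: (@continuous_big R^o); first exact: add_continuous.
move=> m _ t.
have ht : (2 * pi * (m%:Z - b%:Z)%:~R * x) @[x --> t] -->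
    2 * pi * (m%:Z - b%:Z)%:~R * t.
  by apply: cvgM; [exact: cvg_cst|exact: cvg_id].
apply: cvgB; apply: cvgM; try exact: cvg_cst.
  by apply: continuous_cvg => //; exact: continuous_cos.
by apply: continuous_cvg => //; exact: continuous_sin.
Qed.

Lemma bandlimited_measurable b g : bandlimited b g -> measurable_fun setT g.
Proof.
by move=> /bandlimited_continuous; exact: continuous_measurable_fun.
Qed.

Lemma bandlimited_cos b (r : R) : (1 <= b)%N -> `|r| <= 1 ->
  bandlimited b (fun t => r * cos (2 * pi * t)).
Proof.
move=> b1 r1; split; last first.
  by move=> t; rewrite normrM mulr_ile1// cos_max.
exists (fun k => if `|k| == 1 then (r / 2)%:C%C else 0) => t.
(* Frequency k sits at index k + b, so the two nonzero terms of Euler's formula, k = 1 and k = -1,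
   are at [b.+1] and [b.-1]; the latter relies on [1 <= b]. *)
have ltp : (b.+1 < (2 * b).+1)%N by lia.
have ltm : (b.-1 < (2 * b).+1)%N by lia.
rewrite (bigD1 (Ordinal ltp)) //= (bigD1 (Ordinal ltm)) /=; last first.
  by rewrite -val_eqE/=; lia.
rewrite big1 ?addr0; last first.
  move=> m /andP[]; rewrite -!val_eqE/= => mp mm.
  rewrite ifF ?mul0r//; apply/negbTE; lia.
have -> : (b.+1%:Z - b%:Z = 1)%R by lia.
have -> : (b.-1%:Z - b%:Z = -1)%R by lia.
rewrite normrN normr1 eqxx mulr1 mulrN1z mulrN1 mulNr.
set z := 2 * pi * t.
have -> : 'i%C * z%:C%C = (0 +i* z)%C by simpc.
have -> : 'i%C * (- z)%:C%C = (0 +i* (- z))%C by simpc.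
rewrite /cexp /= expR0 !mul1r cosN sinN.
by simpc; congr (_ +i* _)%C; field.
Qed.

End trig.

(** * Lebesgue measure under translation and over one period *)

Section leb.
Context {R : realType}.
Local Notation mu := (@lebesgue_measure R).
Local Open Scope ereal_scope.

(** The pushforward of [mu] by the translation agrees with [mu] on the intervals []a, b]], which
    determine it. *)
Lemma lebesgue_measure_shift (A : set R) (c : R) : measurable A ->
  mu [set t | A (t - c)%R] = mu A.
Proof.
move=> mA; apply/esym.
pose f : measurableTypeR R -> measurableTypeR R := fun t => (t - c)%R.
have mf : measurable_fun setT f by apply: measurable_funB.
apply: (@lebesgue_measure_unique R (pushforward mu f)) => //= _ [[a b]] _ <-.
have -> : pushforward mu f `]a, b] = mu `](a + c)%R, (b + c)%R]%classic.
  congr (mu _); apply/seteqP; split=> t /=; rewrite !in_itv/= /f;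
    by rewrite ltrBrDr lerBlDr.
rewrite !lebesgue_measure_itv/= !lte_fin ltrD2r.
by case: ifP => // _; rewrite -!EFinB; congr (_%:E); ring.
Qed.

(** The half-open interval is a fundamental domain for period 1, so its translates can be cut and
    reassembled without overlap; the dropped endpoint 1 is a null set. *)
Lemma uniform_prob01E (A : set R) : measurable A ->
  uniform_prob (@ltr01 R) A = mu (A `&` `[0%R, 1%R[).
Proof.
move=> mA; rewrite /uniform_prob integral_uniform_pdf.
transitivity (\int[mu]_(x in A `&` `[0%R, 1%R]) cst 1 x).
  apply: eq_integral => x; rewrite inE => -[_]; rewrite /= in_itv/= => x01.
  by rewrite /uniform_pdf x01 subr0 invr1.
rewrite integral_cst ?mul1e; last exact: measurableI.
have -> : `[0%R, 1%R]%classic = `[0%R, 1%R[%classic `|` [set 1%R] :> set R.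
  by rewrite setUitv1// bnd_simp.
rewrite setIUr.
apply/eqP; rewrite eq_le; apply/andP; split; last first.
  by apply: le_measure => //; rewrite ?inE//; do ?apply: measurableU;
    do ?apply: measurableI => //.
apply: (le_trans (measureU2 _ _ _)); do ?apply: measurableI => //.
rewrite -[leRHS]adde0 leeD2l// -(lebesgue_measure_set1 (1%R : R)).
by apply: le_measure => //; rewrite ?inE//; do ?apply: measurableI => //.
Qed.

(** Translating back by [c] turns the window into [-c, 1 - c[. Cut it at 0: by periodicity the piece
    [-c, 0[ can be moved by 1 onto [1 - c, 1[, which completes [0, 1 - c[ to a full period. *)
Lemma lebesgue_measure_periodic_shift (A : set R) (c : R) : measurable A ->
  (forall t, A (t + 1)%R <-> A t) -> (0 < c < 1)%R ->
  mu ([set t | A (t - c)%R] `&` `[0%R, 1%R[) = mu (A `&` `[0%R, 1%R[).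
Proof.
move=> mA Aper /andP[c0 c1].
have mAI i : measurable (A `&` [set` Interval i.1 i.2] : set R).
  by apply: measurableI.
have split3 (x y z : R) : (x <= y <= z)%R ->
    mu (A `&` `[x, z[) = mu (A `&` `[x, y[) + mu (A `&` `[y, z[).
  move=> /andP[xy yz]; rewrite -measureU.
  - rewrite -setIUr; congr (mu (_ `&` _)); apply/seteqP; split=> t /=.
      rewrite !in_itv/= => /andP[xt tz].
      by case: (ltP t y) => ty; [left|right]; rewrite ?xt ?tz.
    rewrite !in_itv/= => -[/andP[xt ty]|/andP[yt tz]].
      by rewrite xt (lt_le_trans ty).
    by rewrite tz (le_trans xy).
  - exact: (mAI (_, _)).
  - exact: (mAI (_, _)).
  - rewrite -subset0 => t /= [[_]]; rewrite !in_itv/= => /andP[_ ty] [_ /andP[]].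
    by rewrite leNgt ty.
have -> : [set t | A (t - c)%R] `&` `[0%R, 1%R[ =
    [set t | (A `&` `[(- c)%R, (1 - c)%R[) (t - c)%R].
  apply/seteqP; split=> t /=; rewrite !in_itv/= => -[? ?]; split=> //; lra.
rewrite lebesgue_measure_shift; last exact: (mAI (_, _)).
rewrite (split3 (- c)%R 0%R); last by lra.
rewrite (split3 0%R (1 - c)%R 1%R); last by lra.
rewrite addeC; congr (_ + _).
rewrite -(lebesgue_measure_shift 1); last exact: (mAI (_, _)).
congr (mu _); apply/seteqP; split=> t /=; rewrite !in_itv/= => -[At t01];
  (split; last lra).
  by have := Aper (t - 1)%R; rewrite subrK => ->.
by have := Aper (t - 1)%R; rewrite subrK => <-.
Qed.

End leb.

(** * Deterministic estimates for means and series *)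

Section det.
Context {R : realType}.

Lemma sqrtn_exists (n : nat) : exists k, (k ^ 2 <= n < k.+1 ^ 2)%N.
Proof.
have ex : exists k, (k ^ 2 <= n)%N by exists 0%N.
have ub k : (k ^ 2 <= n)%N -> (k <= n)%N.
  by apply: leq_trans; case: k => // k; rewrite leq_pmulr.
case: (ex_maxnP ex ub) => k kn kmax; exists k; rewrite kn ltnNge.
by apply/negP => /kmax; rewrite ltnn.
Qed.

(** If k^2 <= n < (k + 1)^2, at most 2k bounded terms follow the first k^2, so they contribute at
    most 2k / n <= 2 / k to the mean. *)
Lemma cvg_mean_of_squares (x : nat -> R) :
  (forall i, `|x i| <= 1) ->
  (k.+1 ^ 2)%:R^-1 * \sum_(i < k.+1 ^ 2) x i @[k --> \oo] --> 0 ->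
  n%:R^-1 * \sum_(i < n) x i @[n --> \oo] --> 0.
Proof.
move=> x1 /cvgrPdist_lt xsq; apply/cvgrPdist_lt => e e0.
have e20 : 0 < e / 2 by lra.
have [K _ HK] := xsq _ e20.
(* For k > 4 / e the tail bound 2k is below (e / 2) k^2; the block of k^2 terms uses the other e /
   2. *)
have [M HM] : exists M : nat, 4 / e < M%:R.
  by exists (Num.truncn (4 / e)).+1; exact: truncnS_gt.
exists ((K + M).+2 ^ 2)%N => // n /= Nn.
have [k /andP[kn nk]] := sqrtn_exists n.
have kKM : ((K + M).+1 < k)%N.
  have := leq_ltn_trans Nn nk; rewrite ltn_exp2r//.
have {HK} : `|0 - (k ^ 2)%:R^-1 * \sum_(i < k ^ 2) x i| < e / 2.
  have := HK k.-1; rewrite prednK; last lia.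
  apply; rewrite /=; lia.
rewrite !sub0r !normrN !normrM => Hk.
have k0 : 0 < (k%:R : R) by rewrite ltr0n; lia.
have n0 : 0 < (n%:R : R) by rewrite ltr0n; lia.
have kn' : (k ^ 2)%:R <= n%:R :> R by rewrite ler_nat.
have tail : `|\sum_(i < n) x i| <= `|\sum_(i < k ^ 2) x i| + 2 * k%:R.
  rewrite -(big_mkord xpredT) (big_cat_nat (n := (k ^ 2)%N))//= big_mkord.
  apply: (le_trans (ler_normD _ _)); rewrite lerD2l.
  apply: (le_trans (ler_norm_sum _ _ _)).
  apply: (@le_trans _ _ (\sum_(k ^ 2 <= i < n) 1)); first exact: ler_sum.
  rewrite sumr_const_nat -natrM ler_nat.
  by rewrite leq_subLR; move: nk; rewrite !expnS !expn0; nia.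
have kM : 4 / e < k%:R by rewrite (lt_le_trans HM)// ler_nat; lia.
have k20 : 0 < ((k ^ 2)%:R : R) by rewrite natrX exprn_gt0.
rewrite ger0_norm ?invr_ge0 ?ltW// mulrC ltr_pdivrMr//.
apply: (le_lt_trans tail).
move: Hk; rewrite ger0_norm ?invr_ge0 ?ltW// mulrC ltr_pdivrMr// => Hk.
move: kM; rewrite ltr_pdivrMr// => kM.
have : 4 * k%:R < e * (k ^ 2)%:R by rewrite natrX; nra.
nra.
Qed.

Lemma sum_inv_sq_le2 (n : nat) : \sum_(k < n) ((k.+1 ^ 2)%:R^-1 : R) <= 2.
Proof.
case: n => [|n]; first by rewrite big_ord0.
(* Strengthened for the induction: 1 / (z + 1)^2 <= 1 / z - 1 / (z + 1), with difference 1 / (z (z +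
   1)^2). *)
suff : \sum_(k < n.+1) ((k.+1 ^ 2)%:R^-1 : R) <= 2 - n.+1%:R^-1.
  by move=> /le_trans; apply; rewrite gerBl.
elim: n => [|n IH]; first by rewrite big_ord1 exp1n invr1; lra.
rewrite big_ord_recr/=; apply: (le_trans (lerD IH (lexx _))).
rewrite natrX -(natr1 n.+1).
have : 1 <= n.+1%:R :> R by rewrite ler1n.
move: (n.+1%:R) => z z1.
have z0 : 0 < z by lra.
rewrite -subr_ge0.
have -> : 2 - (z + 1)^-1 - (2 - z^-1 + (z + 1) ^- 2) = (z * (z + 1) ^+ 2)^-1.
  by field; rewrite !gt_eqF//; lra.
by rewrite invr_ge0 mulr_ge0// ?sqr_ge0// ltW.
Qed.

End det.

(** * A strong law for bounded orthogonal variables *)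

Section slln.
Context d (T : measurableType d) (R : realType) (P : probability T R).
Local Open Scope ereal_scope.

(** Expanding the square, the off-diagonal terms integrate to 0 and each of the n diagonal terms to
    at most 1. *)
Lemma orthogonal_sum_second_moment (X : nat -> T -> R) :
  (forall i, measurable_fun setT (X i)) ->
  (forall i w, `|X i w| <= 1)%R ->
  (forall i j, i != j -> \int[P]_w (X i w * X j w)%:E = 0) ->
  forall n, \int[P]_w ((\sum_(i < n) X i w) ^+ 2)%:E <= n%:R%:E.
Proof.
move=> mX X1 X0 n.
have int i j : P.-integrable setT (fun w => (X i w * X j w)%:E).
  apply: measurable_bounded_integrable => //.
  - exact: fin_num_fun_lty.
  - exact: measurable_funM.
  - exists 1%R; split => // M M1 w _ /=.
    by rewrite normrM (le_trans _ (ltW M1))// mulr_ile1.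
have -> : \int[P]_w ((\sum_(i < n) X i w) ^+ 2)%:E =
    \int[P]_w (\sum_(i < n) \sum_(j < n) (X i w * X j w)%:E).
  apply: eq_integral => w _.
  rewrite expr2 mulr_suml -sumEFin; apply: eq_bigr => i _.
  by rewrite mulr_sumr -sumEFin.
rewrite integral_sum//; last by move=> i; exact: integrable_sum.
under eq_bigr => i _.
  rewrite integral_sum// (bigD1 i)//= big1 ?adde0.
  over.
  by move=> j ji; rewrite X0// eq_sym.
apply: (@le_trans _ _ (\sum_(i < n) 1%:E)); last first.
  by rewrite sumEFin sumr_const card_ord.
apply: lee_sum => i _.
apply: (@le_trans _ _ (\int[P]_w cst 1 w)); last first.
  by rewrite integral_cst// mul1e probability_le1.
apply: ge0_le_integral => //.
- by move=> w _; rewrite lee_fin -expr2 sqr_ge0.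
- by apply/measurable_EFinP; exact: measurable_funM.
- by move=> w _; rewrite lee_fin (le_trans (ler_norm _))// normrM mulr_ile1.
Qed.

(** The mean [Y k] of the first (k + 1)^2 terms has second moment at most 1 / (k + 1)^2. These
    bounds are summable, so the series of [Y k ^+ 2] has finite expectation, hence converges almost
    surely and its terms tend to 0. *)
Lemma slln_orthogonal (X : nat -> T -> R) :
  (forall i, measurable_fun setT (X i)) ->
  (forall i w, `|X i w| <= 1)%R ->
  (forall i j, i != j -> \int[P]_w (X i w * X j w)%:E = 0) ->
  {ae P, forall w, (n%:R^-1 * \sum_(i < n) X i w)%R @[n --> \oo] --> (0 : R)%R}.
Proof.
move=> mX X1 X0.
pose Y k w : R := ((k.+1 ^ 2)%:R^-1 * \sum_(i < k.+1 ^ 2) X i w)%R.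
have mY k : measurable_fun setT (Y k).
  by apply: measurable_funM => //; exact: measurable_sum.
have mY2 k : measurable_fun setT (fun w => (Y k w ^+ 2)%:E).
  by apply/measurable_EFinP; exact: measurable_funX.
have Y20 k w : 0 <= (Y k w ^+ 2)%:E by rewrite lee_fin sqr_ge0.
have EY k : \int[P]_w (Y k w ^+ 2)%:E <= ((k.+1 ^ 2)%:R^-1)%:E.
  under eq_integral do rewrite exprMn EFinM.
  rewrite ge0_integralZl_EFin//; last 2 first.
  - by move=> w _; rewrite lee_fin sqr_ge0.
  - by apply/measurable_EFinP/measurable_funX; exact: measurable_sum.
  apply: (@le_trans _ _ (((k.+1 ^ 2)%:R^-1 ^+ 2)%:E * (k.+1 ^ 2)%:R%:E)).
    by apply: lee_wpmul2l; rewrite ?lee_fin//; exact: orthogonal_sum_second_moment.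
  by rewrite -EFinM lee_fin expr2 -mulrA mulVf ?mulr1// pnatr_eq0.
have intY : P.-integrable setT (fun w => \sum_(k <oo) (Y k w ^+ 2)%:E).
  apply/integrableP; split.
    by apply: ge0_emeasurable_sum.
  under eq_integral do rewrite gee0_abs ?nneseries_ge0//.
  rewrite integral_nneseries//.
  apply: (@le_lt_trans _ _ 2%:E); last exact: ltry.
  apply: lime_le.
    by apply: is_cvg_nneseries => *; exact: integral_ge0.
  apply: nearW => n; rewrite big_mkord.
  apply: (@le_trans _ _ (\sum_(k < n) ((k.+1 ^ 2)%:R^-1)%:E)).
    by apply: lee_sum.
  by rewrite sumEFin lee_fin sum_inv_sq_le2.
apply: filterS (integrable_ae measurableT intY) => w /(_ I) Yw.
apply: (@cvg_mean_of_squares _ (X^~ w)) => //.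
have Ylty : \sum_(0 <= k <oo) (Y k w ^+ 2)%:E < +oo by rewrite ltey_eq Yw.
have tail0 := nneseries_tail_cvg Ylty (fun k _ => Y20 k w).
have /fine_cvg/= : (Y k w ^+ 2)%:E @[k --> \oo] --> 0%:E.
  (* A nonnegative term is at most the tail of the series that starts with it. *)
  apply: (squeeze_cvge _ (cvg_cst 0) tail0); apply: nearW => k.
  rewrite Y20/=.
  have := @nneseries_lim_ge R (fun k => (Y k w ^+ 2)%:E) xpredT k k.+1.
  by rewrite big_nat1; apply.
move=> /cvgrPdist_lt Y2; apply/cvgrPdist_lt => e e0.
have := Y2 _ (exprn_gt0 2 e0); apply: filterS => k.
rewrite !sub0r !normrN normrX ltr_pXn2r// nnegrE//; exact: ltW.
Qed.
End slln.

(** * Convergence of monotone functions from countably many points *)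

Section monotone.
Context {R : realType}.

(* For [inr p] this is the least point at which a right-continuous [F] reaches
   the level [p]; it is a junk value when that level set is empty or unbounded
   below. *)
Definition determining_point (F : R -> R) (i : rat + rat) : R :=
  match i with
  | inl q => ratr q
  | inr p => inf [set y | ratr p <= F y]
  end.

(** Monotonicity squeezes [Fn n x] between its values at determining points on either side of [x].
    On the right a rational suffices by right continuity. On the left [F] may jump at [x], so
    rationals below [x] can miss [F x]; a quantile of level just under [F x] does not, as it may be
    [x] itself. *)
Lemma cvg_of_determining_points (F : R -> R) (Fn : nat -> R -> R) :
  {homo F : x y / x <= y} ->
  (forall x e, 0 < e -> exists2 y, x < y & F y < F x + e) ->
  (forall n, {homo Fn n : x y / x <= y}) ->
  (forall i, Fn n (determining_point F i) @[n --> \oo] -->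
             F (determining_point F i)) ->
  forall x, Fn n x @[n --> \oo] --> F x.
Proof.
move=> ndF rcF ndFn cvD x; apply/cvgrPdist_lt => e e0.
have [y xy Fy] := rcF x _ e0.
have [q /itvP qxy] := rat_in_itvoo xy.
have Fq : F (ratr q) < F x + e by rewrite (le_lt_trans _ Fy)// ndF// qxy.
have [i ix Fi] : exists2 i, determining_point F i <= x &
    F x - e < F (determining_point F i).
  have [p /itvP pF] : exists p, ratr p \in `]F x - e, F x[.
    by apply: rat_in_itvoo; lra.
  pose E := [set y | ratr p <= F y].
  have Ex : E x by rewrite /E/= pF.
  have [lbE|nlbE] := pselect (has_lbound E).
    (* Were [F (inf E)] below the level, right continuity would keep [F] below it at some larger
       [z], which would then be a lower bound of [E]. *)
    have infE : ratr p <= F (inf E).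
      rewrite leNgt; apply/negP => Fm.
      have [z mz Fz] := rcF (inf E) (ratr p - F (inf E)) ltac:(lra).
      have : z <= inf E.
        apply: lb_le_inf; first by exists x.
        move=> u Eu; rewrite leNgt; apply/negP => /ltW/ndF Fuz.
        have := le_trans Eu Fuz; lra.
      by rewrite leNgt mz.
    exists (inr p); first exact: ge_inf.
    by rewrite (lt_le_trans _ infE)// pF.
  (* If [E] is unbounded below, [F] is at least [ratr p] everywhere, and any rational below [x]
     serves. *)
  have [r /itvP rx] : exists r, ratr r \in `]x - 1, x[.
    by apply: rat_in_itvoo; lra.
  exists (inl r); first by rewrite /= rx.
  have [z Ez zr] : exists2 z, E z & z < ratr r.
    apply: contrapT => nz; apply: nlbE; exists (ratr r) => z Ez.
    by rewrite leNgt; apply/negP => zr; apply: nz; exists z.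
  rewrite (@lt_le_trans _ _ (ratr p)) ?pF// (le_trans Ez)// ndF//.
  exact: ltW.
have near_q := cvgr_lt _ (cvD (inl q)) _ Fq.
have near_i := cvgr_gt _ (cvD i) _ Fi.
near=> n.
have ub : Fn n x < F x + e.
  apply: (@le_lt_trans _ _ (Fn n (ratr q))); first by apply: ndFn; rewrite qxy.
  by near: n; exact: near_q.
have lb : F x - e < Fn n x.
  apply: (@lt_le_trans _ _ (Fn n (determining_point F i))); last exact: ndFn.
  by near: n; exact: near_i.
rewrite ltr_norml; lra.
Unshelve. all: by end_near. Qed.

End monotone.

Lemma ae_forall_countable d (T : measurableType d) (R : realType)
    (mu : {measure set T -> \bar R}) (I : countType) (Q : I -> T -> Prop) :
  (forall i, {ae mu, forall w, Q i w}) -> {ae mu, forall w, forall i, Q i w}.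
Proof.
move=> aeQ.
have : {ae mu, forall w, forall n : nat,
    match choice.unpickle n : option I with Some i => Q i w | None => True end}.
  apply: ae_foralln => n; case: (choice.unpickle n) => [i|]; first exact: aeQ.
  exact: aeW.
by apply: filterS => w Qw i; have := Qw (choice.pickle i); rewrite choice.pickleK.
Qed.

(** * The Glivenko-Cantelli argument *)

Section gc.
Context d (T : measurableType d) (R : realType) (P : probability T R).
Local Open Scope ereal_scope.

(** Pairwise independence makes the centred indicators orthogonal: the integral of their product is
    P (E i and E j) - p^2 = 0. *)
Lemma slln_events (E : nat -> set T) (p : R) :
  (forall i, measurable (E i)) -> (forall i, P (E i) = p%:E) ->
  (forall i j, i != j -> P (E i `&` E j) = P (E i) * P (E j)) ->
  {ae P, forall w,
    (n%:R^-1 * \sum_(i < n) \1_(E i) w)%R @[n --> \oo] --> (p : R)}.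
Proof.
move=> mE PE indE.
have p01 : (0 <= p <= 1)%R.
  by rewrite -!lee_fin -(PE 0%N) measure_ge0 probability_le1.
pose X i w : R := (\1_(E i) w - p)%R.
have mX i : measurable_fun setT (X i) by apply: measurable_funB.
have X1 i w : (`|X i w| <= 1)%R.
  by rewrite /X indicE ler_norml; case: (w \in E i) => /=; lra.
have int1 A : measurable A -> P.-integrable setT (EFin \o \1_A : T -> \bar R).
  by move=> mA; apply: integrable_indic => //; rewrite -ge0_fin_numE// fin_num_measure.
have X0 i j : i != j -> \int[P]_w (X i w * X j w)%:E = 0.
  move=> ij.
  transitivity (\int[P]_w ((\1_(E i `&` E j) w)%:E +
      ((- p)%:E * (\1_(E i) w)%:E + ((- p)%:E * (\1_(E j) w)%:E + (p ^+ 2)%:E)))).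
    apply: eq_integral => w _.
    rewrite -!EFinM -!EFinD /X indicI/=; congr (_%:E); ring.
  have mEij := measurableI _ _ (mE i) (mE j).
  have intc : P.-integrable setT (cst (p ^+ 2)%:E).
    by apply: finite_measure_integrable_cst.
  have intZ k : P.-integrable setT (fun w => (- p)%:E * (\1_(E k) w)%:E).
    by apply: integrableZl => //; exact: int1.
  rewrite integralD//; [|exact: int1|by do 2 (apply: integrableD => //)].
  rewrite integralD//; last by apply: integrableD.
  rewrite integralD// !integralZl//; try exact: int1.
  rewrite !integral_indic// !setIT.
  have -> : \int[P]__ (p ^+ 2)%:E = (p ^+ 2)%:E.
    by rewrite (integral_cst P measurableT (p ^+ 2)%:E) [X in _ * X]probability_setT mule1.
  transitivity ((p * p)%:E + ((- p)%:E * p%:E + ((- p)%:E * p%:E + (p ^+ 2)%:E))).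
    congr (_ + (_ * _ + (_ * _ + _))); [|exact: PE|exact: PE].
    by apply: (etrans (indE _ _ ij)); rewrite !PE.
  by rewrite -!EFinM -!EFinD; congr (_%:E); ring.
apply: filterS (slln_orthogonal mX X1 X0) => w.
move=> /cvgrPdist_lt X_; apply/cvgrPdist_lt => e e0.
(* [N.+1] excludes n = 0, where the inverse is 0 by convention and the mean of the constant [p]
   would not be [p]. *)
have [N _ HN] := X_ _ e0; exists N.+1 => // n /= Nn.
have := HN n (ltnW Nn); rewrite /X sumrB sumr_const card_ord mulrBr.
rewrite -[(p *+ n)%R]mulr_natl mulKf; last by rewrite pnatr_eq0; lia.
by rewrite sub0r opprB.
Qed.

(** The law for events at each determining point leaves a countable union of null sets; off it, the
    deterministic squeeze treats all [x] at once. Independence enters only for half-lines with a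
    common endpoint. *)
Lemma glivenko_cantelli (Y : nat -> {RV P >-> R}) :
  (forall i, cdf (Y i) = cdf (Y 0%N)) ->
  (forall i j x, i != j ->
    P (Y i @^-1` `]-oo, x] `&` Y j @^-1` `]-oo, x]) =
    P (Y i @^-1` `]-oo, x]) * P (Y j @^-1` `]-oo, x])) ->
  {ae P, forall w x,
    (n%:R^-1 * \sum_(i < n) \1_(`]-oo, x]) (Y i w))%R @[n --> \oo] -->
    fine (cdf (Y 0%N) x)}.
Proof.
move=> cdfY indY.
pose F x : R := fine (cdf (Y 0%N) x).
have FE x : (F x)%:E = cdf (Y 0%N) x by rewrite fineK// fin_num_measure.
have ndF : {homo F : x y / (x <= y)%R}.
  by move=> x y xy; rewrite -lee_fin !FE cdf_nondecreasing.
have rcF x (e : R) : (0 < e)%R -> exists2 y, (x < y)%R & (F y < F x + e)%R.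
  move=> e0.
  have : F y @[y --> x^'+] --> F x.
    by apply: fine_cvg; rewrite FE; exact: cdf_right_continuous.
  move=> /cvgr_lt/(_ (F x + e)%R); rewrite ltrDl => /(_ e0) nF.
  by have [y []] := filter_ex (filterI (nbhs_right_gt x) nF); exists y.
have pointwise x : {ae P, forall w,
    (n%:R^-1 * \sum_(i < n) \1_(`]-oo, x]) (Y i w))%R @[n --> \oo] --> F x}.
  apply: (@slln_events (fun i => Y i @^-1` `]-oo, x])) => [i|i|i j ij].
  - exact: measurable_funPTI.
  - by rewrite FE -(cdfY i).
  - exact: indY.
have := ae_forall_countable (fun i => pointwise (determining_point F i)).
apply: filterS => w cvD.
apply: (cvg_of_determining_points ndF rcF _ cvD) => n x y xy.
rewrite ler_wpM2l ?invr_ge0//; apply: ler_sum => i _.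
rewrite !indicE ler_nat; case: (boolP (Y i w \in `]-oo, x]%classic)) => //=.
rewrite !inE/= !in_itv/= => Yx; rewrite lt0b mem_set//= in_itv/=.
exact: le_trans xy.
Qed.

End gc.

(** * Uniform samples of a field *)

Section sampling.
Context d (T : measurableType d) (R : realType) (P : probability T R).

Lemma mutually_independent_pair (U : nat -> {RV P >-> R}) i j (A : set R) :
  mutually_independent U -> i != j -> measurable A ->
  P (U i @^-1` A `&` U j @^-1` A) = (P (U i @^-1` A) * P (U j @^-1` A))%E.
Proof.
move=> indU ij mA.
have := indU [fset i; j]%fset (fun=> A) (fun _ _ => mA).
rewrite big_fsetU1/= ?inE// big_seq_fset1 => <-; congr (P _).
apply/seteqP; split=> w.
  by move=> [Ui Uj] k; rewrite /= !inE => /orP[]/eqP->.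
by move=> Uij; split; apply: Uij; rewrite /= !inE eqxx ?orbT.
Qed.

Lemma uniform01_preimage (V : {RV P >-> R}) (A : set R) :
  uniform01 V -> measurable A ->
  P (V @^-1` A) = lebesgue_measure (A `&` `[0, 1[).
Proof. by move=> uV mA; rewrite -uniform_prob01E//; exact: uV. Qed.

Lemma uniform01_periodic_shift (V : {RV P >-> R}) (A : set R) (c : R) :
  uniform01 V -> measurable A -> (forall t, A (t + 1) <-> A t) -> 0 < c < 1 ->
  P (V @^-1` [set t | A (t - c)]) = P (V @^-1` A).
Proof.
move=> uV mA Aper c01.
have mAc : measurable [set t | A (t - c)].
  rewrite -[X in measurable X]setTI.
  by apply: (measurable_funB (@measurable_id _ _ setT)
    (@measurable_cst _ _ _ _ setT c)).
by rewrite !uniform01_preimage// lebesgue_measure_periodic_shift.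
Qed.

Lemma empirical_cdf_cvg (U : nat -> {RV P >-> R}) (g : R -> R) :
  mutually_independent U -> (forall i, uniform01 (U i)) ->
  measurable_fun setT g ->
  {ae P, forall w, forall x : R,
     (empirical_cdf g (fun i => U i w) n x)%:E @[n --> \oo] -->
     P [set w' | g (U 0%N w') <= x]}.
Proof.
move=> indU uU mg.
have mpre x : measurable (g @^-1` `]-oo, x]).
  by rewrite -[X in measurable X]setTI; exact: mg.
pose gU i : {RV P >-> R} := HB.pack (g \o U i)
  (isMeasurableFun.Build _ _ _ _ (g \o U i)
    (measurableT_comp mg (measurable_funPT (U i)))).
(* The samples start at [U 1], whereas the limit is stated with [U 0]; [gUE] gives all [gU i] the
   same law and so bridges the two. *)
pose Y i := gU i.+1.
have gUE i x : cdf (gU i) x = lebesgue_measure (g @^-1` `]-oo, x] `&` `[0, 1[).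
  exact: (uniform01_preimage (uU i) (mpre x)).
have := @glivenko_cantelli _ _ _ P Y.
have cdfY i : cdf (Y i) = cdf (Y 0%N) by apply/funext => x; rewrite !gUE.
move=> /(_ cdfY) GC.
have {}GC := GC (fun i j x ij =>
  @mutually_independent_pair U i.+1 j.+1 _ indU ij (mpre x)).
apply: filterS GC => w GC x.
have -> : P [set w' | g (U 0%N w') <= x] = (fine (cdf (Y 0%N) x))%:E.
  rewrite fineK ?fin_num_measure// gUE -(gUE 0%N).
  by congr (P _); apply/seteqP; split=> w' /=; rewrite in_itv.
have empE n : empirical_cdf g (fun i => U i w) n x =
    n%:R^-1 * \sum_(i < n) \1_(`]-oo, x]) (Y i w).
  by rewrite /empirical_cdf big_add1/= big_mkord.
under eq_fun do rewrite empE.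
by apply: cvg_EFin; [exact: nearW|exact: GC].
Qed.

End sampling.

(* U 0 is the generic variable U, and U 1, U 2, ... are the samples. *)
Theorem mainTheorem1 (R : realType) (b : nat) (hb : (1 <= b)%N)
    (d : measure_display) (T : measurableType d) (P : probability T R)
    (U : nat -> {RV P >-> R})
    (hindep : mutually_independent U)
    (hunif : forall i : nat, uniform01 (U i)) :
  (forall g : R -> R, bandlimited b g ->
     {ae P, forall w : T, forall x : R, -1 <= x <= 1 ->
        (empirical_cdf g (fun i => U i w) n x)%:E @[n --> \oo] -->
        P [set w' | g (U 0%N w') <= x]})
  /\
  (forall g : R -> R, bandlimited b g ->
   forall theta : R, 0 < theta < 1 ->
   forall x : R, -1 <= x <= 1 ->
     P [set w | shift_field theta g (U 0%N w) <= x] =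
     P [set w | g (U 0%N w) <= x])
  /\
  (exists g h : R -> R,
     [/\ bandlimited b g, bandlimited b h, g <> h &
         forall x : R, -1 <= x <= 1 ->
           P [set w | g (U 0%N w) <= x] = P [set w | h (U 0%N w) <= x]]).
Proof.
have shiftE g (theta : R) (x : R) : bandlimited b g -> 0 < theta < 1 ->
    P [set w | shift_field theta g (U 0%N w) <= x] =
    P [set w | g (U 0%N w) <= x].
  move=> bg th01.
  apply: (@uniform01_periodic_shift _ _ _ P (U 0%N) [set t | g t <= x]) => //.
    have -> : [set t | g t <= x] = g @^-1` `]-oo, x].
      by apply/seteqP; split=> t /=; rewrite in_itv.
    by rewrite -[X in measurable X]setTI; exact: (bandlimited_measurable bg).
  by move=> t; rewrite /= (bandlimited_periodic _ bg).
split; [|split].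
- move=> g bg.
  have := empirical_cdf_cvg hindep hunif (bandlimited_measurable bg).
  by apply: filterS => w cv x _; exact: cv.
- by move=> g bg theta th01 x _; exact: shiftE.
(* The half-period shift of the cosine is its negative. The factors 1 and -1 match the amplitude [r]
   of [bandlimited_cos], and evaluation at 0 separates the two fields. *)
- pose g (t : R) := 1 * cos (2 * pi * t).
  pose h (t : R) := -1 * cos (2 * pi * t).
  have bg : bandlimited b g by apply: bandlimited_cos; rewrite ?normr1.
  have bh : bandlimited b h by apply: bandlimited_cos; rewrite ?normrN1.
  have hE : h = shift_field (1 / 2) g.
    apply/funext => t; rewrite /h /shift_field /g.
    have -> : 2 * pi * t = 2 * pi * (t - 1 / 2) + pi by field.
    by rewrite cosDpi mulrNN.
  exists g, h; split => //.
    move=> /(congr1 (fun f => f 0)); rewrite /g /h mulr0 cos0; lra.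
  by move=> x _; rewrite hE shiftE//; lra.
Qed.
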